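(* Let $\Phi=\{\phi_i\}_{i=1}^n\subset L^2(X,\rho)$. Let $(\Omega,\mathcal F,\mathbb P)$ be a probability space and let $\delta_1,\dots,\delta_n\in L^2(\Omega;L^\infty(X))$ be random functions such that $\mathbb E[\delta_i(x)]=0$ for every $x\in X$ and every $i$, and $\mathbb E[\overline{\delta_i(x)}\,\delta_j(x)]=0$ for every $x\in X$ and all $i\ne j$. Define $\widetilde\Phi=\{\widetilde\phi_i\}_{i=1}^n$ by $\widetilde\phi_i=\phi_i(1+\delta_i)$. Let $u>0$ and assume that there exists a constant $C>0$ such that $\mathbb E[\|\widetilde\phi_i-\phi_i\|_{L^2_\rho}^2]\ge Cu^2$ for $1\le i\le n$. Then, for every $f\in L^2(X,\rho)$, the best root mean square error of $f$ in $\mathrm{span}(\widetilde\Phi)$ satisfies $$\inf_{v\in\mathrm{span}(\widetilde\Phi)}\sqrt{\mathbb E\|v-f\|_{L^2_\rho}^2}\ \ge\ \inf_{c\in\mathbb C^n}\frac1{\sqrt2}\left(\|\mathcal Tc-f\|_{L^2_\rho}+u\sqrt C\,\|c\|_2\right),$$ where $\mathcal Tc=\sum_{i=1}^n c_i\phi_i$.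
   Context: $X\subseteq\mathbb R^d$ is measurable and $\rho$ is a non-atomic probability measure on $X$. $L^2(X,\rho)$ is the complex Hilbert space with norm $\|\cdot\|_{L^2_\rho}$, and $\|\cdot\|_2$ is the Euclidean norm on $\mathbb C^n$. The condition $\delta_i\in L^2(\Omega;L^\infty(X))$ means that $\delta_i:\Omega\to L^\infty(X)$ is Bochner square-integrable, i.e. $\mathbb E[\|\delta_i\|_{L^\infty}^2]<\infty$; the dependence on $\omega\in\Omega$ is suppressed. $\mathrm{span}(\widetilde\Phi)$ denotes the set of random functions $\sum_{i=1}^n c_i\widetilde\phi_i$ with deterministic coefficients $c\in\mathbb C^n$ (the span in $L^2(\Omega;L^2(X,\rho))$). The number $u$ plays the role of the unit roundoff. *)

(* Defs.v *)
(* MathComp-Analysis; complex numbers are R[i] from mathcomp-real-closed. *)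
From mathcomp Require Export all_boot all_order all_algebra.
From mathcomp Require Export all_classical all_reals all_analysis.
From mathcomp Require Export complex.

Set Implicit Arguments.
Unset Strict Implicit.
Unset Printing Implicit Defensive.

Import Order.TTheory GRing.Theory Num.Theory.
Import numFieldNormedType.Exports.

Local Open Scope classical_set_scope.
Local Open Scope ring_scope.

(* The product sigma-algebra on tuples is the Borel sigma-algebra of R^d. *)
Notation euclid R d := (d.-tuple (measurableTypeR R)).

Section complex_functions.
Context {R : realType}.

(* |z| as an element of R; the MathComp norm `|z| lives in R[i]. *)
Definition cabs (z : R[i]) : R := complex.Re `|z|.

Definition cmeasurable_fun d (T : measurableType d) (D : set T)
    (f : T -> R[i]) : Prop :=
  measurable_fun D (fun x => complex.Re (f x)) /\
  measurable_fun D (fun x => complex.Im (f x)).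

(* Norm of L^p(X, rho). A function on X is represented by a function on the
   ambient type whose values outside X are discarded. *)
Definition cLnorm d (T : measurableType d) (rho : {measure set T -> \bar R})
    (X : set T) (p : \bar R) (f : T -> R[i]) : \bar R :=
  'N[rho]_p[((fun x => (cabs (f x))%:E) \_ X)%E].

Definition in_cLp d (T : measurableType d) (rho : {measure set T -> \bar R})
    (X : set T) (p : \bar R) (f : T -> R[i]) : Prop :=
  cmeasurable_fun X f /\ (cLnorm rho X p f < +oo)%E.

(* E[Y] = m. The integrals are taken in \bar R, and a measurable function whose
   integral is finite is integrable: that the expectation is well defined is
   thus part of the condition. *)
Definition cexpectation_is d (Omega : measurableType d)
    (P : probability Omega R) (Y : Omega -> R[i]) (m : R[i]) : Prop :=
  ('E_P[fun w => complex.Re (Y w)] = (complex.Re m)%:E)%E /\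
  ('E_P[fun w => complex.Im (Y w)] = (complex.Im m)%:E)%E.

End complex_functions.

Definition non_atomic (R : realType) d (T : measurableType d)
    (rho : {measure set T -> \bar R}) : Prop :=
  forall A : set T, measurable A -> (0 < rho A)%E ->
  exists B : set T, [/\ measurable B, B `<=` A, (0 < rho B)%E &
    (rho B < rho A)%E].

Section random_functions.
Context {R : realType} {d dO : measure_display}.
Context {T : measurableType d} {Omega : measurableType dO}.
Variables (P : probability Omega R) (rho : {measure set T -> \bar R}).
Variable X : set T.

Definition Linfty_simple (s : Omega -> T -> R[i]) : Prop :=
  [/\ finite_set (range s),
      forall g, measurable (s @^-1` [set g]) &
      forall w, in_cLp rho X +oo%E (s w)].

Definition strongly_measurable_Linfty (delta : Omega -> T -> R[i]) : Prop :=
  exists s : nat -> Omega -> T -> R[i],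
    (forall k, Linfty_simple (s k)) /\
    {ae P, forall w,
      cLnorm rho X +oo%E (fun x => s k w x - delta w x) @[k --> \oo] --> 0%E}.

(* delta in L^2(Omega; L^oo(X, rho)), in the sense of Bochner. Since delta is
   also to be evaluated at points of X, it stands for a jointly measurable
   representative; every Bochner-measurable L^oo-valued map has one, and for
   other representatives the pointwise moments E[delta(x)] are unrelated to the
   L^oo-valued map. *)
Definition in_L2_Linfty (delta : Omega -> T -> R[i]) : Prop :=
  [/\ cmeasurable_fun (setT `*` X) (fun z : Omega * T => delta z.1 z.2),
      forall w, in_cLp rho X +oo%E (delta w),
      strongly_measurable_Linfty delta &
      (\int[P]_w (cLnorm rho X +oo%E (delta w) ^+ 2) < +oo)%E].

(* E ||v||^2, where ||.|| is the norm of L^2(X, rho) *)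
Definition mean_square (v : Omega -> T -> R[i]) : \bar R :=
  (\int[P]_w (cLnorm rho X 2%:E (v w) ^+ 2))%E.

(* The coefficients c do not depend on w. *)
Definition random_span n (psi : 'I_n -> Omega -> T -> R[i]) :
    set (Omega -> T -> R[i]) :=
  [set v | exists c : 'rV[R[i]]_n,
     v = fun w x => \sum_(i < n) c ord0 i * psi i w x].

End random_functions.

Section synthesis.
Context {R : realType}.

Definition synthesis T n (phi : 'I_n -> T -> R[i]) (c : 'rV[R[i]]_n) :
    T -> R[i] :=
  fun x => \sum_(i < n) c ord0 i * phi i x.

Definition cnorm2 n (c : 'rV[R[i]]_n) : R :=
  Num.sqrt (\sum_(i < n) cabs (c ord0 i) ^+ 2).

Definition perturb T Omega (phi : T -> R[i]) (delta : Omega -> T -> R[i]) :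
    Omega -> T -> R[i] :=
  fun w x => phi x * (1 + delta w x).

End synthesis.

(* Main.v *)
Require Import Defs.
From mathcomp Require Import ring lra measurable_realfun.
Set Implicit Arguments.
Unset Strict Implicit.
Unset Printing Implicit Defensive.

Import Order.TTheory GRing.Theory Num.Theory.
Import numFieldNormedType.Exports.
Local Open Scope classical_set_scope.
Local Open Scope ring_scope.

(** The bound is a bias-variance decomposition. For coefficients c the error
    at a point x splits as
    [g x + \sum_i c_i * phi_i x * delta_i x], with the deterministic bias
    [g = synthesis phi c - f]. Since the [delta_i x] are centered and pairwise
    uncorrelated, all cross terms vanish in expectation
    ([second_moment_uncorrelated]):
      [E|g x + ...|^2 = |g x|^2 + \sum_i E|c_i * phi_i x * delta_i x|^2].
    Integrating over x and exchanging the integrals ([mean_square_tonelli])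
    gives the exact identity [mean_square_bias_variance]
      [E||v - f||^2 = ||g||^2 + \sum_i |c_i|^2 * E||phi~_i - phi_i||^2],
    with [phi~_i = phi_i * (1 + delta_i)].
    By hypothesis the last sum is at least [C u^2 ||c||^2], and
    [sqrt (a^2 + b^2) >= (a + b) / sqrt 2] ([sqrte_ge_half_sum]) bounds the
    error of each element of the span by the expression for the same c on the
    other side; the infima compare accordingly.

    Everything is carried out in the extended reals, where the identity holds
    also when a second moment is infinite. Only the cross terms have to be
    integrable, and this is what a finite value of their expectation says
    ([centeredP]). *)

(** * Squared moduli of complex numbers *)

Section cplx.
Context {R : realType}.
Implicit Types (z g : R[i]) (r : R).

Lemma cabs_ge0 z : 0 <= cabs z.
Proof. by rewrite /cabs normc_def /= sqrtr_ge0. Qed.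

Lemma cabs_sqr z : cabs z ^+ 2 = complex.Re z ^+ 2 + complex.Im z ^+ 2.
Proof. by rewrite /cabs normc_def /= sqr_sqrtr // addr_ge0 ?sqr_ge0. Qed.

Lemma cabs_sqrM z g : cabs (z * g) ^+ 2 = cabs z ^+ 2 * cabs g ^+ 2.
Proof. by rewrite !cabs_sqr; case: z g => [a b] [c e] /=; ring. Qed.

Lemma cabs_sqrE z : (cabs z ^+ 2)%:C%C = z^*%C * z.
Proof. by rewrite cabs_sqr add_Re2_Im2 sqr_normc mulrC. Qed.

Lemma cReD z g : complex.Re (z + g) = complex.Re z + complex.Re g.
Proof. by case: z g => [a b] [c e]. Qed.

Lemma cImD z g : complex.Im (z + g) = complex.Im z + complex.Im g.
Proof. by case: z g => [a b] [c e]. Qed.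

(** The last summand collects the terms whose expectation vanishes: they are
    linear in [z] or in the products [(z i)^* * z j] with [i != j]. *)
Lemma cabs_sqr_expand n g (a z : 'I_n -> R[i]) :
  cabs (g + \sum_i a i * z i) ^+ 2 =
  cabs g ^+ 2 + \sum_i cabs (a i * z i) ^+ 2
  + complex.Re (2 * g^*%C * (\sum_i a i * z i)
       + \sum_i \sum_(j | i != j) (a i)^*%C * a j * ((z i)^*%C * z j)).
Proof.
set S := \sum_i a i * z i; set Q := (X in complex.Re (_ + X)).
have SQ : cabs S ^+ 2 = \sum_i cabs (a i * z i) ^+ 2 + complex.Re Q.
  have -> : cabs S ^+ 2 = complex.Re (S^*%C * S) by rewrite -cabs_sqrE.
  have -> : S^*%C * S = (\sum_i cabs (a i * z i) ^+ 2)%:C%C + Q.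
    rewrite [X in X * _](_ : _ = \sum_i (a i * z i)^*%C); last exact: raddf_sum.
    rewrite big_distrl /= [X in X + _]rmorph_sum -big_split /=.
    apply: eq_bigr => i _; rewrite [X in X + _]cabs_sqrE big_distrr /=.
    rewrite (bigD1 i) //=; congr (_ + _).
    by apply: eq_big => [j|j _]; rewrite 1?eq_sym // rmorphM mulrACA.
  by rewrite cReD.
have -> : cabs (g + S) ^+ 2 =
    cabs g ^+ 2 + cabs S ^+ 2 + complex.Re (2 * g^*%C * S).
  by rewrite !cabs_sqr; case: (S) g => [a0 b0] [c e] /=; ring.
by rewrite SQ cReD; ring.
Qed.
End cplx.

(** * Centered random variables *)

Section centered.
Context {R : realType} {d : measure_display} {Omega : measurableType d}.
Context (P : probability Omega R).
Implicit Types (r F : Omega -> R) (Y Z : Omega -> R[i]).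

Definition real_centered r : Prop :=
  P.-integrable setT (EFin \o r) /\ (\int[P]_w (r w)%:E = 0)%E.

(** The integral is the difference of the integrals of the positive and the
    negative part, and in the extended reals a difference is finite only when
    both terms are. *)
Lemma finite_integral_integrable (h : Omega -> \bar R) :
  measurable_fun setT h -> (\int[P]_w h w)%E \is a fin_num ->
  P.-integrable setT h.
Proof.
move=> mh; rewrite integralE fin_numB => /andP[ip im].
apply/integrableP; split => //.
rewrite (eq_integral (h^\+ \+ h^\-)%E); last first.
  by move=> w _; exact: (congr1 (@^~ w) (fune_abse h)).
rewrite ge0_integralD //=.
- by rewrite lte_add_pinfty // ltey_eq ?ip ?im.
- exact: measurable_funepos.
- exact: measurable_funeneg.
Qed.

Lemma real_centered_comb r1 r2 k l : real_centered r1 -> real_centered r2 ->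
  real_centered (fun w => k * r1 w + l * r2 w).
Proof.
move=> [i1 e1] [i2 e2].
have i1' := integrableZl measurableT k i1.
have i2' := integrableZl measurableT l i2.
split; first exact: (integrableD measurableT i1' i2').
rewrite (integralD measurableT i1' i2') !integralZl //=.
by rewrite e1 e2 !mule0 adde0.
Qed.

(** [F] may have infinite integral, so the integral cannot be split directly.
    Instead [F + r] plus the negative part of [r] is [F] plus the positive part
    of [r]; all four functions are nonnegative, and the two parts of [r] have the
    same finite integral, which cancels. *)
Lemma ge0_integral_centeredD F r : measurable_fun setT F ->
  (forall w, 0 <= F w) -> (forall w, 0 <= F w + r w) -> real_centered r ->
  (\int[P]_w (F w + r w)%:E = \int[P]_w (F w)%:E)%E.
Proof.
move=> mF F0 Fr0 [ir er].
have mr : measurable_fun setT (EFin \o r) by case/integrableP: ir.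
have mF' : measurable_fun setT (EFin \o F) by exact/measurable_EFinP.
have mFr : measurable_fun setT (fun w => (F w + r w)%:E).
  exact: (emeasurable_funD mF' mr).
have ip := integrable_pos_fin_num measurableT ir.
have im := integrable_neg_fin_num measurableT ir.
have epm : (\int[P]_w (EFin \o r)^\+ w = \int[P]_w (EFin \o r)^\- w)%E.
  move: er; rewrite integralE => /eqP.
  by rewrite sube_eq ?fin_num_adde_defl // add0e => /eqP.
have : (\int[P]_w ((F w + r w)%:E + (EFin \o r)^\- w) =
        \int[P]_w ((F w)%:E + (EFin \o r)^\+ w))%E.
  apply: eq_integral => w _.
  rewrite funepos.unlock funeneg.unlock /= -!EFin_max -!EFinD; congr EFin.
  by rewrite /Num.max; case: ifP; case: ifP; lra.
have mrp := measurable_funepos mr; have mrn := measurable_funeneg mr.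
have F0' w : setT w -> (0 <= (F w)%:E)%E by rewrite lee_fin.
have Fr0' w : setT w -> (0 <= (F w + r w)%:E)%E by rewrite lee_fin.
rewrite !ge0_integralD // epm.
by move=> /(congr1 (fun y => y - \int[P]_w (EFin \o r)^\- w)%E); rewrite !addeK.
Qed.

Definition centered Y : Prop :=
  real_centered (fun w => complex.Re (Y w)) /\
  real_centered (fun w => complex.Im (Y w)).

Lemma centeredP Y : cmeasurable_fun setT Y -> cexpectation_is P Y 0 ->
  centered Y.
Proof.
rewrite /cexpectation_is !expectation.unlock.
move=> [mRe mIm] [eRe eIm].
split; (split; last by []); apply: finite_integral_integrable.
- exact/measurable_EFinP.
- by rewrite eRe.
- exact/measurable_EFinP.
- by rewrite eIm.
Qed.

Lemma centeredD Y Z : centered Y -> centered Z ->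
  centered (fun w => Y w + Z w).
Proof.
move=> [Y1 Y2] [Z1 Z2]; split.
  by have := real_centered_comb 1 1 Y1 Z1; under eq_fun do rewrite !mul1r -cReD.
by have := real_centered_comb 1 1 Y2 Z2; under eq_fun do rewrite !mul1r -cImD.
Qed.

Lemma centeredZ a Y : centered Y -> centered (fun w => a * Y w).
Proof.
case: a => a b [Y1 Y2]; split.
  rewrite (_ : (fun w => _) =
      (fun w => a * complex.Re (Y w) + - b * complex.Im (Y w))).
    exact: real_centered_comb.
  by apply/funext => w; case: (Y w) => c e /=; rewrite mulNr.
rewrite (_ : (fun w => _) =
    (fun w => a * complex.Im (Y w) + b * complex.Re (Y w))).
  exact: real_centered_comb.
by apply/funext => w; case: (Y w).
Qed.

Lemma centered_sum (I : Type) (s : seq I) (A : pred I) (Y : I -> Omega -> R[i]) :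
  (forall i, A i -> centered (Y i)) ->
  centered (fun w => \sum_(i <- s | A i) Y i w).
Proof.
move=> cY; elim: s => [|i s IH].
  under eq_fun do rewrite big_nil.
  have c0 : real_centered (fun=> 0).
    by split; [exact: integrable0|rewrite integral0].
  by split.
have [Ai|/negbTE nAi] := boolP (A i); last first.
  by under eq_fun do rewrite big_cons nAi.
under eq_fun do rewrite big_cons Ai.
by apply: centeredD => //; exact: cY.
Qed.

End centered.

(** * Complex measurability and the L^2 norm *)

Section second_moment.
Context {R : realType} {d : measure_display} {T : measurableType d}.
Implicit Types (D : set T) (f g : T -> R[i]).

Lemma cmeasurable_cst D (z : R[i]) : cmeasurable_fun D (fun=> z).
Proof. by split; exact: measurable_cst. Qed.

Lemma cmeasurableD D f g : cmeasurable_fun D f -> cmeasurable_fun D g ->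
  cmeasurable_fun D (fun x => f x + g x).
Proof.
move=> [f1 f2] [g1 g2]; split.
  by under eq_fun do rewrite cReD; exact: measurable_funD.
by under eq_fun do rewrite cImD; exact: measurable_funD.
Qed.

Lemma cmeasurableM D f g : cmeasurable_fun D f -> cmeasurable_fun D g ->
  cmeasurable_fun D (fun x => f x * g x).
Proof.
move=> [f1 f2] [g1 g2]; split.
  rewrite (_ : (fun x => _) = (fun x => complex.Re (f x) * complex.Re (g x)
    - complex.Im (f x) * complex.Im (g x))).
    by apply: measurable_funB; exact: measurable_funM.
  by apply/funext => x; case: (f x) (g x) => [a b] [c e].
rewrite (_ : (fun x => _) = (fun x => complex.Re (f x) * complex.Im (g x)
  + complex.Im (f x) * complex.Re (g x))).
  by apply: measurable_funD; exact: measurable_funM.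
by apply/funext => x; case: (f x) (g x) => [a b] [c e].
Qed.

Lemma cmeasurableJ D f : cmeasurable_fun D f ->
  cmeasurable_fun D (fun x => (f x)^*%C).
Proof.
move=> [f1 f2]; split.
  by rewrite (_ : (fun x => _) = (fun x => complex.Re (f x)));
    [|apply/funext => x; case: (f x)].
rewrite (_ : (fun x => _) = (fun x => - complex.Im (f x))).
  exact: measurableT_comp.
by apply/funext => x; case: (f x).
Qed.

Lemma cmeasurableB D f g : cmeasurable_fun D f -> cmeasurable_fun D g ->
  cmeasurable_fun D (fun x => f x - g x).
Proof.
move=> mf mg; under eq_fun do rewrite -[- g _]mulN1r.
by apply: cmeasurableD => //; apply: cmeasurableM => //; exact: cmeasurable_cst.
Qed.

Lemma cmeasurable_sum D (I : Type) (s : seq I) (F : I -> T -> R[i]) :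
  (forall i, cmeasurable_fun D (F i)) ->
  cmeasurable_fun D (fun x => \sum_(i <- s) F i x).
Proof.
move=> mF; elim: s => [|i s IH].
  by under eq_fun do rewrite big_nil; exact: cmeasurable_cst.
by under eq_fun do rewrite big_cons; exact: cmeasurableD.
Qed.

Lemma measurable_cabs_sqr D f : cmeasurable_fun D f ->
  measurable_fun D (fun x => (cabs (f x) ^+ 2)%:E).
Proof.
move=> [f1 f2]; apply/measurable_EFinP.
under eq_fun do rewrite cabs_sqr.
by apply: measurable_funD; exact: measurable_funX.
Qed.

Lemma cLnorm2E (rho : {measure set T -> \bar R}) X f :
  cLnorm rho X 2%:E f = sqrte (\int[rho]_(x in X) (cabs (f x) ^+ 2)%:E)%E.
Proof.
rewrite /cLnorm Lnorm.unlock poweR12_sqrt; last first.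
  by apply: integral_ge0 => x _; exact: poweR_ge0.
congr sqrte; rewrite [RHS]integral_mkcond; apply: eq_integral => x _.
rewrite /patch; case: ifP => _.
  by rewrite poweR_EFin ger0_norm ?cabs_ge0 // powR_mulrn // cabs_ge0.
by rewrite abse0 poweR_EFin powR0.
Qed.

Lemma cLnorm2_sqr (rho : {measure set T -> \bar R}) X f :
  (cLnorm rho X 2%:E f ^+ 2 = \int[rho]_(x in X) (cabs (f x) ^+ 2)%:E)%E.
Proof.
rewrite cLnorm2E sqr_sqrte // integral_ge0 // => x _.
by rewrite lee_fin sqr_ge0.
Qed.

End second_moment.

(** * Second moments of uncorrelated combinations *)

Section orthogonality.
Context {R : realType} {d : measure_display} {Omega : measurableType d}.
Context (P : probability Omega R).

(** The cross terms of [cabs_sqr_expand] form a centered variable, which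
    [ge0_integral_centeredD] discards even if some [z i] has an infinite second
    moment. *)
Lemma second_moment_uncorrelated n (g : R[i]) (a : 'I_n -> R[i])
    (z : 'I_n -> Omega -> R[i]) :
  (forall i, cmeasurable_fun setT (z i)) ->
  (forall i, cexpectation_is P (z i) 0) ->
  (forall i j, i != j -> cexpectation_is P (fun w => (z i w)^*%C * z j w) 0) ->
  (\int[P]_w (cabs (g + \sum_i a i * z i w) ^+ 2)%:E =
   (cabs g ^+ 2)%:E + \sum_i \int[P]_w (cabs (a i * z i w) ^+ 2)%:E)%E.
Proof.
move=> mz z0 zz0.
have maz i : cmeasurable_fun setT (fun w => a i * z i w).
  by apply: cmeasurableM => //; exact: cmeasurable_cst.
have mazE i := measurable_cabs_sqr (maz i).
pose D w := cabs g ^+ 2 + \sum_i cabs (a i * z i w) ^+ 2.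
pose Y w := 2 * g^*%C * (\sum_i a i * z i w)
  + \sum_i \sum_(j | i != j) (a i)^*%C * a j * ((z i w)^*%C * z j w).
have cY : centered P Y.
  apply: centeredD.
    apply: centeredZ; apply: centered_sum => i _; apply: centeredZ.
    exact: centeredP (mz i) (z0 i).
  apply: centered_sum => i _; apply: centered_sum => j ij; apply: centeredZ.
  by apply: centeredP; [apply: cmeasurableM => //; exact: cmeasurableJ|exact: zz0].
have DY w : cabs (g + \sum_i a i * z i w) ^+ 2 = D w + complex.Re (Y w).
  exact: cabs_sqr_expand.
transitivity (\int[P]_w (D w)%:E)%E.
  under eq_integral do rewrite DY.
  apply: ge0_integral_centeredD.
  - apply: measurable_funD => //; apply: measurable_sum => i.
    by move/measurable_EFinP: (mazE i).
  - by move=> w; rewrite /D addr_ge0 ?sqr_ge0 // sumr_ge0 // => i _; exact: sqr_ge0.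
  - by move=> w; rewrite -DY sqr_ge0.
  - by case: cY.
under eq_integral do rewrite EFinD -sumEFin.
rewrite ge0_integralD //=.
- have := expectation_cst P (cabs g ^+ 2); rewrite expectation.unlock /= => ->.
  rewrite ge0_integral_sum //.
  by move=> i w _; rewrite lee_fin sqr_ge0.
- by move=> w _; rewrite lee_fin sqr_ge0.
- by move=> w _; apply: sume_ge0 => i _; rewrite lee_fin sqr_ge0.
- exact: emeasurable_sum.
Qed.

End orthogonality.

(** * Exchanging expectation and spatial integration *)

Section tonelli.
Context {R : realType} {d dO : measure_display}.
Context {T : measurableType d} {Omega : measurableType dO}.
Context (P : probability Omega R).
Context (rho : {sigma_finite_measure set T -> \bar R}).
Context (X : set T) (mX : measurable X) (v : Omega -> T -> R[i]).
Context (mv : cmeasurable_fun (setT `*` X) (fun y : Omega * T => v y.1 y.2)).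

Let mTX : measurable ((setT : set Omega) `*` X).
Proof. exact: measurableX. Qed.

Lemma cmeasurable_section x : X x -> cmeasurable_fun setT (v^~ x).
Proof.
move=> Xx; have sub : (fun w : Omega => (w, x)) @` setT `<=` setT `*` X.
  by move=> _ [w _ <-].
have mp := @pair2_measurable _ _ Omega T x.
by case: mv => m1 m2; split; [exact: (measurable_comp mTX sub m1 mp)|
  exact: (measurable_comp mTX sub m2 mp)].
Qed.

(* Extending the integrand by 0 outside X turns the iterated integral over
   Omega and X into one over the full product, where Tonelli applies. *)
Let G := (fun y : Omega * T => (cabs (v y.1 y.2) ^+ 2)%:E) \_ (setT `*` X).

Let mG : measurable_fun setT G.
Proof. by have /(measurable_restrictT _ mTX) := measurable_cabs_sqr mv. Qed.

Let G_ge0 y : (0 <= G y)%E.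
Proof. by rewrite /G patchE; case: ifP => // _; rewrite lee_fin sqr_ge0. Qed.

Let GE w x : G (w, x) = ((fun x => (cabs (v w x) ^+ 2)%:E) \_ X) x.
Proof. by rewrite /G !patchE in_setX in_setT. Qed.

Let int_G : (fun x => \int[P]_w G (w, x))%E =
  (fun x => \int[P]_w (cabs (v w x) ^+ 2)%:E)%E \_ X.
Proof.
apply/funext => x; rewrite patchE.
under eq_integral do rewrite GE patchE.
by case: ifP => // _; rewrite integral0.
Qed.

Lemma measurable_second_moment :
  measurable_fun X (fun x => \int[P]_w (cabs (v w x) ^+ 2)%:E)%E.
Proof.
apply/(measurable_restrictT _ mX); rewrite -int_G.
exact: measurable_fun_fubini_tonelli_G.
Qed.

Lemma mean_square_tonelli : mean_square P rho X v =
  (\int[rho]_(x in X) \int[P]_w (cabs (v w x) ^+ 2)%:E)%E.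
Proof.
rewrite /mean_square; under eq_integral do rewrite cLnorm2_sqr.
rewrite [RHS]integral_mkcond -int_G -fubini_tonelli //.
apply: eq_integral => w _; rewrite integral_mkcond.
by apply: eq_integral => x _; rewrite GE.
Qed.

End tonelli.

(** * The mean-square error of an element of the random span *)

Section bias_variance.
Context {R : realType} {d dO : measure_display}.
Context {T : measurableType d} {Omega : measurableType dO}.
Context (P : probability Omega R).
Context (rho : {sigma_finite_measure set T -> \bar R}).
Context (X : set T) (mX : measurable X).

Lemma cmeasurable_snd (f : T -> R[i]) : cmeasurable_fun X f ->
  cmeasurable_fun ((setT : set Omega) `*` X) (fun y => f y.2).
Proof.
have sub : snd @` ((setT : set Omega) `*` X) `<=` X by move=> _ [y [_ Xy] <-].
have ms : measurable_fun ((setT : set Omega) `*` X) (@snd Omega T).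
  by move=> mTX Y mY; apply: measurableI => //;
    rewrite -[snd @^-1` Y]setTI; exact: measurable_snd.
by move=> [f1 f2]; split; [exact: (measurable_comp mX sub f1 ms)|
  exact: (measurable_comp mX sub f2 ms)].
Qed.

(** The bias and the fluctuation are orthogonal at every point of [X], so the
    squared norms add up; no cross term between different [delta i] survives. *)
Lemma mean_square_bias_variance n (phi : 'I_n -> T -> R[i])
    (delta : 'I_n -> Omega -> T -> R[i]) (f : T -> R[i]) (c : 'rV[R[i]]_n) :
  (forall i, cmeasurable_fun X (phi i)) ->
  (forall i, cmeasurable_fun (setT `*` X) (fun y => delta i y.1 y.2)) ->
  (forall i x, X x -> cexpectation_is P (fun w => delta i w x) 0) ->
  (forall i j x, i != j -> X x ->
    cexpectation_is P (fun w => (delta i w x)^*%C * delta j w x) 0) ->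
  cmeasurable_fun X f ->
  (mean_square P rho X (fun w x =>
     \sum_i c ord0 i * perturb (phi i) (delta i) w x - f x)%R =
   cLnorm rho X 2%:E (fun x => synthesis phi c x - f x)%R ^+ 2 +
   \sum_i (cabs (c ord0 i) ^+ 2)%:E * mean_square P rho X
     (fun w x => perturb (phi i) (delta i) w x - phi i x)%R)%E.
Proof.
move=> mphi mdelta delta0 delta_unc mf.
pose g x := synthesis phi c x - f x.
have mg : cmeasurable_fun X g.
  apply: cmeasurableB => //; apply: cmeasurable_sum => i.
  by apply: cmeasurableM => //; exact: cmeasurable_cst.
pose e i w x := phi i x * delta i w x.
have eE i : (fun w x => perturb (phi i) (delta i) w x - phi i x) = e i.
  by apply/funext => w; apply/funext => x; rewrite /perturb /e; ring.
have me i : cmeasurable_fun (setT `*` X) (fun y : Omega * T => e i y.1 y.2).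
  by apply: cmeasurableM => //; exact: cmeasurable_snd.
have -> : (fun w x => \sum_i c ord0 i * perturb (phi i) (delta i) w x - f x) =
    (fun w x => g x + \sum_i (c ord0 i * phi i x) * delta i w x).
  apply/funext => w; apply/funext => x; rewrite /g /synthesis addrAC -big_split.
  by congr (_ - _); apply: eq_bigr => i _; rewrite /perturb /=; ring.
rewrite mean_square_tonelli //; last first.
  apply: cmeasurableD; first exact: cmeasurable_snd.
  apply: cmeasurable_sum => i; apply: cmeasurableM => //.
  apply: (@cmeasurable_snd (fun x => c ord0 i * phi i x)).
  by apply: cmeasurableM => //; exact: cmeasurable_cst.
pose V i x := (\int[P]_w (cabs (e i w x) ^+ 2)%:E)%E.
have V0 i x : (0 <= V i x)%E.
  by apply: integral_ge0 => w _; rewrite lee_fin sqr_ge0.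
have mV i : measurable_fun X (V i) by exact: measurable_second_moment.
have mcV i : measurable_fun X (fun x => (cabs (c ord0 i) ^+ 2)%:E * V i x)%E.
  by apply: emeasurable_funM => //; exact: measurable_cst.
have cV0 i x : (0 <= (cabs (c ord0 i) ^+ 2)%:E * V i x)%E.
  by rewrite mule_ge0 // lee_fin sqr_ge0.
transitivity (\int[rho]_(x in X) ((cabs (g x) ^+ 2)%:E +
    \sum_i (cabs (c ord0 i) ^+ 2)%:E * V i x))%E.
  apply: eq_integral => x /set_mem Xx.
  rewrite second_moment_uncorrelated; last 3 first.
  - by move=> i; exact: (cmeasurable_section mX (mdelta i) Xx).
  - by move=> i; exact: delta0.
  - by move=> i j ij; exact: delta_unc.
  congr (_ + _)%E; apply: eq_bigr => i _.
  rewrite -ge0_integralZl_EFin ?sqr_ge0 //; last 2 first.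
  - by move=> w _; rewrite lee_fin sqr_ge0.
  - exact: measurable_cabs_sqr (cmeasurable_section mX (me i) Xx).
  by apply: eq_integral => w _; rewrite -EFinM -cabs_sqrM mulrA.
rewrite ge0_integralD //; last 4 first.
- by move=> x _; rewrite lee_fin sqr_ge0.
- exact: measurable_cabs_sqr.
- by move=> x _; apply: sume_ge0.
- exact: emeasurable_sum.
rewrite cLnorm2_sqr ge0_integral_sum //; congr (_ + _)%E.
apply: eq_bigr => i _; rewrite eE mean_square_tonelli //.
by rewrite ge0_integralZl_EFin // sqr_ge0.
Qed.

End bias_variance.

(** This is the inequality [(a + b)^2 <= 2 (a^2 + b^2)]. *)
Lemma sqrte_ge_half_sum (R : realType) (A M : \bar R) (b : R) :
  (0 <= A)%E -> 0 <= b -> (A ^+ 2 + (b ^+ 2)%:E <= M)%E ->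
  ((Num.sqrt 2)^-1%:E * (A + b%:E) <= sqrte M)%E.
Proof.
move=> A0 b0 AM.
have M0 : (0 <= M)%E.
  by apply: le_trans AM; rewrite adde_ge0 ?expe_ge0 // lee_fin sqr_ge0.
have [->|Mfin] := eqVneq M +oo%E; first by rewrite leey.
case: A A0 AM => [a||] //; last first.
  by move=> _; rewrite expe2 mulyy /= leye_eq => /eqP MN; rewrite MN in Mfin.
rewrite lee_fin -EFin_expe -EFinD => a0; case: M M0 Mfin => // m m0 _.
rewrite lee_fin => abm; rewrite -EFinD -EFinM /= lee_fin.
have s0 : 0 <= (Num.sqrt 2)^-1 :> R by rewrite invr_ge0 sqrtr_ge0.
have s2 : (Num.sqrt 2)^-1 ^+ 2 = 2^-1 :> R by rewrite exprVn sqr_sqrtr.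
rewrite -[X in X <= _]ger0_norm ?mulr_ge0 ?addr_ge0 // -sqrtr_sqr ler_wsqrtr //.
rewrite exprMn s2; apply: le_trans abm.
by have := sqr_ge0 (a - b); rewrite !expr2; lra.
Qed.

Theorem corollary9 (R : realType) (d : nat) (X : set (euclid R d))
  (mX : measurable X)
  (rho : probability (euclid R d) R) (rhoX : rho X = 1%E)
  (rho_non_atomic : non_atomic rho)
  (dO : measure_display) (Omega : measurableType dO)
  (P : probability Omega R)
  (n : nat) (phi : 'I_n -> euclid R d -> R[i])
  (phi_L2 : forall i, in_cLp rho X 2%:E (phi i))
  (delta : 'I_n -> Omega -> euclid R d -> R[i])
  (delta_L2Linfty : forall i, in_L2_Linfty P rho X (delta i))
  (delta_mean0 : forall (i : 'I_n) x, X x ->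
    cexpectation_is P (fun w => delta i w x) 0)
  (delta_uncorrelated : forall (i j : 'I_n) x, i != j -> X x ->
    cexpectation_is P (fun w => (delta i w x)^*%C * delta j w x) 0)
  (u C : R) (u_gt0 : 0 < u) (C_gt0 : 0 < C)
  (delta_lower : forall i : 'I_n,
    ((C * u ^+ 2)%:E <=
     mean_square P rho X
       (fun w x => (perturb (phi i) (delta i) w x - phi i x)%R))%E)
  (f : euclid R d -> R[i]) (f_L2 : in_cLp rho X 2%:E f) :
  (ereal_inf [set sqrte (mean_square P rho X (fun w x => (v w x - f x)%R)) |
     v in random_span (fun i => perturb (phi i) (delta i))]
   >=
   ereal_inf [set ((Num.sqrt 2)^-1)%:E *
       (cLnorm rho X 2%:E (fun x => (synthesis phi c x - f x)%R)
        + (u * Num.sqrt C * cnorm2 c)%:E) |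
     c in [set: 'rV[R[i]]_n]])%E.
Proof.
apply: le_ereal_inf_tmp => _ [_ [c ->] <-].
apply: le_trans (ereal_inf_lbound _) _; first by exists c.
apply: sqrte_ge_half_sum.
- by rewrite cLnorm2E sqrte_ge0.
- by rewrite !mulr_ge0 ?sqrtr_ge0 // ltW.
rewrite mean_square_bias_variance //; last 3 first.
- by move=> i; case: (phi_L2 i).
- by move=> i; case: (delta_L2Linfty i).
- by case: f_L2.
have S0 : 0 <= \sum_(i < n) cabs (c ord0 i) ^+ 2.
  by apply: sumr_ge0 => i _; exact: sqr_ge0.
rewrite leeD2l // !exprMn sqr_sqrtr ?(ltW C_gt0) // sqr_sqrtr //.
rewrite big_distrr /= -sumEFin; apply: lee_sum => i _.
rewrite [u ^+ 2 * C]mulrC [X in X%:E]mulrC EFinM.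
by rewrite lee_wpmul2l // lee_fin sqr_ge0.
Qed.
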